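(* Let $L>0$ and let $F$ be a function in the class $P(-L,L)$. Then for any $0<W<L/10$ and any $u,u_0,u_1\in[-W,W]$ with $u\ne u_0$ and $u_1\neq u_0$: $$\left|\frac{F(u)-F(u_0)}{u-u_0}-\frac{F(u_1)-F(u_0)}{u_1-u_0}\right|\le\frac{6W}{L}\,\frac{F(u_1)-F(u_0)}{u_1-u_0}.$$
   Context: A Herglotz-Pick function is a function $F$ analytic in the upper half plane $\mathbb{C}^+$ with values there in $\mathbb{C}^+$. Any such function has a unique Herglotz representation $F(z)=a_Fz+b_F+\int\left(\frac1{x-z}-\frac{x}{1+x^2}\right)\mu_F(dx)$ with $a_F\ge0$, $b_F\in\mathbb{R}$ and $\mu_F$ a Borel measure on $\mathbb{R}$ with $\int(1+x^2)^{-1}\mu_F(dx)<\infty$. For an open interval $(a,b)$, $P(a,b)$ denotes the class of Herglotz-Pick functions with $\mu_F((a,b))=0$; these extend analytically through $(a,b)$ and are real valued there, and $F(u)$ for $u\in(a,b)$ denotes the value of this extension. *)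

(* Defs.v *)
From HB Require Import structures.
From mathcomp Require Import all_boot all_order all_algebra.
From mathcomp Require Import complex.
From mathcomp Require Import all_classical all_reals all_analysis.

Set Implicit Arguments.
Unset Strict Implicit.
Unset Printing Implicit Defensive.

Import Order.TTheory GRing.Theory Num.Theory.
Import numFieldNormedType.Exports.

Local Open Scope classical_set_scope.
Local Open Scope ring_scope.
Local Open Scope complex_scope.

Section HerglotzPick.
Variable R : realType.

(* Analyticity is complex differentiability on an open set: the norm topology
   of R[i] is carried by R[i]^o, a normed module over R[i] itself, so that
   [derivable F z 1] takes the limit over complex increments. *)
Implicit Types (F G : R[i]^o -> R[i]^o) (U : set R[i]^o).
Implicit Types mu : {measure set (measurableTypeR R) -> \bar R}.

Definition upper_half_plane : set R[i]^o := [set z | 0 < complex.Im z].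

Definition analytic_on U F := forall z, U z -> derivable F z 1.

Definition herglotz_pick F :=
  analytic_on upper_half_plane F /\
  forall z, upper_half_plane z -> upper_half_plane (F z).

Definition complex_integral mu (f : R -> R[i]) : R[i] :=
  (\int[mu]_x complex.Re (f x))%R +i* (\int[mu]_x complex.Im (f x))%R.

Definition herglotz_kernel (z : R[i]) (x : R) : R[i] :=
  (x%:C - z)^-1 - (x / (1 + x ^+ 2))%:C.

(* The Borel sets of R are the measurable sets of measurableTypeR R. *)
Definition herglotz_representation F (a b : R) mu :=
  [/\ 0 <= a,
      (\int[mu]_x ((1 + x ^+ 2)^-1)%:E < +oo)%E
    & forall z, upper_half_plane z ->
        F z = a%:C * z + b%:C + complex_integral mu (herglotz_kernel z)].

(* The representation is unique, so [exists] selects the measure of F. *)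
Definition pick_class (l r : R) F :=
  herglotz_pick F /\
  exists a b mu, herglotz_representation F a b mu /\ mu `]l, r[%classic = 0%E.

(* F only matters on the upper half plane; its value at a point u of ]l, r[ is
   G u, which does not depend on G because G is continuous at u. *)
Definition analytic_extension (l r : R) F G :=
  exists U, [/\ open U,
    upper_half_plane `<=` U,
    forall x : R, l < x < r -> U x%:C,
    analytic_on U G
  & forall z, upper_half_plane z -> G z = F z].

Definition difference_quotient G (v v0 : R) : R[i] :=
  (G v%:C - G v0%:C) / (v%:C - v0%:C).

End HerglotzPick.

(* Main.v *)
Require Import Defs.
From mathcomp Require Import all_boot all_order all_algebra.
From mathcomp Require Import complex ring lra.
From mathcomp Require Import all_classical all_reals all_analysis.
From mathcomp Require Import measurable_realfun.

Import Order.TTheory GRing.Theory Num.Theory.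
Import numFieldNormedType.Exports.
Local Open Scope classical_set_scope.
Local Open Scope ring_scope.
Local Open Scope complex_scope.

(* Integrating the kernel over the complement of ]l, r[, where it extends to the
   real points v of ]l, r[, gives
     G(v) = a v + b + \int (1 / (x - v) - x / (1 + x^2)) mu(dx),
   so the difference quotient at u, u0 is a + \int mu(dx) / ((x - u)(x - u0)),
   with a positive integrand.  Replacing u1 by u multiplies the integrand by
   1 + (u - u1) / (x - u), and |u - u1| <= 2W while |x - u| >= L/3. *)

(** * Measurability of inverses and quotients *)

Lemma measurable_inv (R : realType) :
  measurable_fun [set: R] (fun x : R => x^-1).
Proof.
(* Inversion is continuous off 0, and the singleton at 0 is handled separately. *)
rewrite -(setvU [set 0 : R]%classic).
apply/measurable_funU; [exact: measurableC|exact: measurable_set1|split].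
- apply: open_continuous_measurable_fun.
    apply: closed_openC.
    exact/accessible_closed_set1/hausdorff_accessible/norm_hausdorff.
  move=> x; rewrite inE => /eqP x0.
  exact: inv_continuous.
- exact: measurable_fun_set1.
Qed.

Lemma measurable_fun_div (R : realType) (f g : R -> R) :
  measurable_fun [set: R] f -> measurable_fun [set: R] g ->
  measurable_fun [set: R] (fun x => f x / g x).
Proof.
move=> mf mg; apply: measurable_funM => //.
by apply: measurableT_comp => //; exact: measurable_inv.
Qed.

(** * Pointwise bounds on the kernel at a real point and above it *)

Section RealKernel.
Variable R : realType.
Implicit Types (v x y : R).

(** The limit of [herglotz_kernel] as its argument descends to the real point [v], for [x] different
    from [v]. *)
Definition real_kernel v x : R := (x - v)^-1 - x / (1 + x ^+ 2).

Lemma measurable_real_kernel v : measurable_fun [set: R] (real_kernel v).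
Proof.
apply: measurable_funB.
  by apply: measurableT_comp; [exact: measurable_inv|exact: measurable_funB].
apply: measurable_fun_div => //.
by apply: measurable_funD => //; exact: measurable_funX.
Qed.

(** From [(x - 2v)^2 >= 0] follows [1 + x^2 <= 2 (x - v)^2 + 2 v^2 + 1], and [(x - v)^2 / d^2 >= 1]
    absorbs the constant term. *)
Lemma inv_sqr_le_weight d v x : 0 < d -> d <= `|x - v| ->
  ((x - v) ^+ 2)^-1 <= (2 + (2 * v ^+ 2 + 1) / d ^+ 2) * (1 + x ^+ 2)^-1.
Proof.
move=> d0 dx; have x0 : 0 < `|x - v| by exact: lt_le_trans dx.
have d2 : d ^+ 2 <= (x - v) ^+ 2.
  by rewrite -[leRHS]real_normK ?num_real// ler_pXn2r ?nnegrE// ltW.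
have d20 : 0 < d ^+ 2 by rewrite exprn_gt0.
have x20 : 0 < (x - v) ^+ 2 by exact: lt_le_trans d2.
have w0 : 0 < 1 + x ^+ 2 by nra.
rewrite ler_pdivlMr// mulrC ler_pdivrMr// mulrDl mulrAC.
have : 2 * v ^+ 2 + 1 <= (2 * v ^+ 2 + 1) * (x - v) ^+ 2 / d ^+ 2.
  by rewrite ler_pdivlMr// ler_wpM2l//; nra.
set q := _ / d ^+ 2; have := sqr_ge0 (x - v - v); lra.
Qed.

Lemma normr_real_kernel_le d v x : 0 < d -> d <= `|x - v| ->
  `|real_kernel v x| <= ((1 + v ^+ 2) / d + `|v|) * (1 + x ^+ 2)^-1.
Proof.
move=> d0 dx; have x0 : 0 < `|x - v| by exact: lt_le_trans dx.
have xv : x - v != 0 by rewrite -normr_gt0.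
have w0 : 0 < 1 + x ^+ 2 by nra.
(* The numerator [1 + x v] over the common denominator splits as [(1 + v^2) + v (x - v)]. *)
have -> : real_kernel v x = ((1 + v ^+ 2) / (x - v) + v) * (1 + x ^+ 2)^-1.
  by rewrite /real_kernel; field; rewrite xv gt_eqF.
rewrite normrM normfV (gtr0_norm w0) ler_pM2r ?invr_gt0//.
rewrite (le_trans (ler_normD _ _))// lerD2r normrM normfV.
rewrite ger0_norm; last by nra.
by rewrite ler_wpM2l ?lef_pV2//; nra.
Qed.

Lemma Re_herglotz_kernel v y x :
  complex.Re (herglotz_kernel (v +i* y) x) =
    (x - v) / ((x - v) ^+ 2 + y ^+ 2) - x / (1 + x ^+ 2).
Proof. by rewrite /herglotz_kernel /= sub0r sqrrN. Qed.

Lemma Im_herglotz_kernel v y x :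
  complex.Im (herglotz_kernel (v +i* y) x) = y / ((x - v) ^+ 2 + y ^+ 2).
Proof. by rewrite /herglotz_kernel /= sub0r sqrrN mulNr opprK oppr0 addr0. Qed.

Lemma measurable_Re_herglotz_kernel z :
  measurable_fun [set: R] (fun x => complex.Re (herglotz_kernel z x)).
Proof.
case: z => v y; under eq_fun do rewrite Re_herglotz_kernel.
have mx : measurable_fun [set: R] (fun x : R => x - v).
  exact: measurable_funB.
apply: measurable_funB; apply: measurable_fun_div => //.
  by apply: measurable_funD => //; exact: measurable_funX.
by apply: measurable_funD => //; exact: measurable_funX.
Qed.

Lemma measurable_Im_herglotz_kernel z :
  measurable_fun [set: R] (fun x => complex.Im (herglotz_kernel z x)).
Proof.
case: z => v y; under eq_fun do rewrite Im_herglotz_kernel.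
have mx : measurable_fun [set: R] (fun x : R => x - v).
  exact: measurable_funB.
apply: measurable_fun_div => //.
by apply: measurable_funD => //; exact: measurable_funX.
Qed.

(** With [A = x - v] the difference is [- y^2 / (A (A^2 + y^2))], and [y |A| <= A^2 + y^2]. The
    factor [y] provides the rate of convergence as [y] tends to 0. *)
Lemma normr_Re_kernel_sub_le v y x : 0 < y -> x - v != 0 ->
  `|complex.Re (herglotz_kernel (v +i* y) x) - real_kernel v x| <=
    y * ((x - v) ^+ 2)^-1.
Proof.
move=> y0; rewrite Re_herglotz_kernel /real_kernel opprB addrA subrK.
set A := x - v => A0.
have A2 : 0 < A ^+ 2 by rewrite exprn_even_gt0.
have s0 : 0 < A ^+ 2 + y ^+ 2 by nra.
have -> : A / (A ^+ 2 + y ^+ 2) - A^-1 = - (y ^+ 2 / (A * (A ^+ 2 + y ^+ 2))).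
  by field; rewrite A0 gt_eqF.
have nA : 0 < `|A| by rewrite normr_gt0.
have nA2 : `|A| ^+ 2 = A ^+ 2 by rewrite real_normK ?num_real.
rewrite normrN normrM normfV [`|A * _|]normrM (gtr0_norm s0).
rewrite ger0_norm ?sqr_ge0//.
rewrite ler_pdivrMr ?mulr_gt0// mulrAC ler_pdivlMr// -nA2.
have : 0 <= y * (`|A| * (`|A| ^+ 2 + y ^+ 2) - y * `|A| ^+ 2).
  apply: mulr_ge0; first exact: ltW.
  (* Completing the square in [|A|^2 - y |A| + y^2]. *)
  have -> : `|A| * (`|A| ^+ 2 + y ^+ 2) - y * `|A| ^+ 2 =
    `|A| * ((`|A| - y / 2) ^+ 2 + 3 / 4 * y ^+ 2) by field.
  by apply: mulr_ge0; nra.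
lra.
Qed.

Lemma normr_Im_kernel_le v y x : 0 < y -> x - v != 0 ->
  `|complex.Im (herglotz_kernel (v +i* y) x)| <= y * ((x - v) ^+ 2)^-1.
Proof.
move=> y0; rewrite Im_herglotz_kernel; set A := x - v => A0.
have A2 : 0 < A ^+ 2 by rewrite exprn_even_gt0.
have s0 : 0 < A ^+ 2 + y ^+ 2 by nra.
rewrite ger0_norm; last by rewrite divr_ge0 ?ltW.
by rewrite ler_pM2l// lef_pV2 ?posrE// lerDl sqr_ge0.
Qed.

End RealKernel.

(** * Integration off the null interval *)

Section BoundaryValue.
Variable R : realType.
(* R and T have convertible measurable sets but distinct displays, so functions
   integrated against mu are given the domain T. *)
Local Notation T := (measurableTypeR R).
Variable mu : {measure set T -> \bar R}.

(** The function and its restriction agree almost everywhere. This moves the integrals off the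
    interval, where the limiting kernel has its pole. *)
Lemma Rintegral_setC_null (N : set T) (f : T -> R) :
  measurable N -> mu N = 0%E -> measurable_fun [set: T] f ->
  (\int[mu]_x f x = \int[mu]_(x in ~` N) f x)%R.
Proof.
move=> mN N0 mf; rewrite [RHS]Rintegral_mkcond /Rintegral; congr fine.
have mC : measurable (~` N) by exact: measurableC.
apply: ae_eq_integral => //.
- exact/measurable_EFinP.
- by apply/measurable_EFinP/(measurable_restrictT f mC)/measurable_funTS.
- change (mu.-negligible
    (~` [set x | setT x -> (f x)%:E = ((f \_ (~` N)) x)%:E])).
  exists N; split => // x /= /not_implyP[_]; apply: contra_notP => Nx.
  by rewrite patchE mem_set.
Qed.

Hypothesis weight_fin : (\int[mu]_x ((1 + x ^+ 2)^-1)%:E < +oo)%E.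

Lemma integrable_weight (D : set T) : measurable D ->
  mu.-integrable D (EFin \o fun x : T => (1 + x ^+ 2)^-1).
Proof.
move=> mD; apply: (@integrableS _ _ _ _ setT) => //.
apply/integrableP; split.
  apply/measurable_EFinP/measurableT_comp; first exact: measurable_inv.
  by apply: (@measurable_funD _ R) => //; exact: measurable_funX.
under eq_integral => x _ do
  rewrite /= ger0_norm ?invr_ge0 ?addr_ge0 ?sqr_ge0//.
exact: weight_fin.
Qed.

Lemma integrable_le_weight (D : set T) (f : T -> R) (C : R) : measurable D ->
  measurable_fun [set: T] f ->
  (forall x, D x -> `|f x| <= C * (1 + x ^+ 2)^-1) ->
  mu.-integrable D (EFin \o f).
Proof.
move=> mD mf fC.
apply: (@le_integrable _ _ R mu D mD (EFin \o f)
  (EFin \o fun x : T => C * (1 + x ^+ 2)^-1)).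
- by apply/measurable_EFinP; exact: measurable_funTS.
- by move=> x Dx; rewrite lee_fin (le_trans (fC _ Dx))// ler_norm.
- exact: (integrableZl mD C (integrable_weight D mD)).
Qed.

Variables l r : R.
Let D : set T := ~` `]l, r[.

Let mD : measurable D. Proof. exact: measurableC. Qed.

Lemma dist_setC_itv v : l < v < r ->
  exists2 d : R, 0 < d & forall x, D x -> d <= `|x - v|.
Proof.
move=> /andP[lv vr]; exists (Num.min (v - l) (r - v)).
  by rewrite lt_min !subr_gt0 lv.
move=> x /negP; rewrite in_itv /= negb_and -!leNgt ge_min => /orP[xl|rx].
  by rewrite distrC ler_normr lerB.
by apply/orP; right; rewrite ler_normr lerB.
Qed.

Lemma integrable_real_kernel v : l < v < r ->
  mu.-integrable D (EFin \o real_kernel R v).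
Proof.
move=> /dist_setC_itv[d d0 dv].
apply: integrable_le_weight => //; first exact: measurable_real_kernel.
by move=> x /dv; exact: normr_real_kernel_le.
Qed.

Hypothesis null_itv : mu `]l, r[%classic = 0%E.

(** The pointwise bound is [y] times a multiple of the weight, so integrating it gives a constant
    free of [y]. This explicit rate takes the place of a dominated convergence argument. *)
Lemma Re_integral_sub_le (v : R) : l < v < r -> exists C, forall y : R, 0 < y ->
  `|\int[mu]_x complex.Re (herglotz_kernel (v +i* y) x) -
    \int[mu]_(x in D) real_kernel R v x| <= y * C.
Proof.
move=> lvr; have [d d0 dv] := dist_setC_itv v lvr.
set c := 2 + (2 * v ^+ 2 + 1) / d ^+ 2.
exists (c * \int[mu]_(x in D) (1 + x ^+ 2)^-1) => y y0.
have Dv x : D x -> x - v != 0.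
  by move=> /dv dx; rewrite -normr_gt0 (lt_le_trans d0).
have mRe := measurable_Re_herglotz_kernel R (v +i* y)
  : measurable_fun [set: T] _.
have mdiff := measurable_funB mRe (measurable_real_kernel R v).
have diff_le x : D x ->
    `|complex.Re (herglotz_kernel (v +i* y) x) - real_kernel R v x| <=
    y * c * (1 + x ^+ 2)^-1.
  move=> Dx; apply: (le_trans (normr_Re_kernel_sub_le _ _ _ _ y0 (Dv _ Dx))).
  by rewrite -mulrA ler_pM2l// inv_sqr_le_weight// dv.
have idiff := integrable_le_weight D _ _ mD mdiff diff_le.
have iker := integrable_real_kernel v lvr.
(* The real part is the sum of two integrable functions: its difference from the real kernel, and
   the real kernel. *)
have iRe : mu.-integrable D
    (EFin \o (fun x : T => complex.Re (herglotz_kernel (v +i* y) x))).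
  apply: (eq_integrable mD _ _ _ (integrableD mD idiff iker)) => x _ /=.
  by rewrite -EFinD subrK.
rewrite (Rintegral_setC_null _ _ (measurable_itv _) null_itv mRe).
rewrite -(RintegralB mD iRe iker).
apply: (le_trans (le_normr_Rintegral mD idiff)).
rewrite mulrA -(RintegralZl _ mD (integrable_weight _ mD)).
apply: (le_Rintegral mD _ _ diff_le).
  exact: (integrable_norm idiff).
exact: (integrableZl mD _ (integrable_weight D mD)).
Qed.

Lemma Im_integral_le (v : R) : l < v < r -> exists C, forall y : R, 0 < y ->
  `|\int[mu]_x complex.Im (herglotz_kernel (v +i* y) x)| <= y * C.
Proof.
move=> lvr; have [d d0 dv] := dist_setC_itv v lvr.
set c := 2 + (2 * v ^+ 2 + 1) / d ^+ 2.
exists (c * \int[mu]_(x in D) (1 + x ^+ 2)^-1) => y y0.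
have Dv x : D x -> x - v != 0.
  by move=> /dv dx; rewrite -normr_gt0 (lt_le_trans d0).
have mIm := measurable_Im_herglotz_kernel R (v +i* y)
  : measurable_fun [set: T] _.
have Im_le x : D x -> `|complex.Im (herglotz_kernel (v +i* y) x)| <=
    y * c * (1 + x ^+ 2)^-1.
  move=> Dx; apply: (le_trans (normr_Im_kernel_le _ _ _ _ y0 (Dv _ Dx))).
  by rewrite -mulrA ler_pM2l// inv_sqr_le_weight// dv.
have iIm := integrable_le_weight D _ _ mD mIm Im_le.
rewrite (Rintegral_setC_null _ _ (measurable_itv _) null_itv mIm).
apply: (le_trans (le_normr_Rintegral mD iIm)).
rewrite mulrA -(RintegralZl _ mD (integrable_weight _ mD)).
apply: (le_Rintegral mD _ _ Im_le).
  exact: (integrable_norm iIm).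
exact: (integrableZl mD _ (integrable_weight D mD)).
Qed.

(** * The value of the extension at real points *)

Variables (F G : R[i]^o -> R[i]^o) (a b : R).
Hypothesis repF : herglotz_representation F a b mu.
Hypothesis extG : analytic_extension l r F G.

(** The Herglotz formula at a real point; integrating over [D] only keeps the pole at [v] out of the
    domain. *)
Definition boundary_value v : R :=
  a * v + b + \int[mu]_(x in D) real_kernel R v x.

(** [G] is continuous at [v] and equals [F] at [v + iy], while the representation of [F] there tends
    to the boundary value as [y] decreases to 0. One sufficiently small [y] leaves an error of at
    most [e] from each source. *)
Lemma analytic_extensionE v : l < v < r -> G v%:C = (boundary_value v)%:C.
Proof.
move=> lvr; have [C1 ReC] := Re_integral_sub_le v lvr.
have [C2 ImC] := Im_integral_le v lvr.
have [U [oU HU itvU anG GF]] := extG.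
have cG : {for v%:C, continuous G}.
  by apply/differentiable_continuous/derivable1_diffP/anG/itvU.
set g := G v%:C; set h := boundary_value v.
suff small (e : R) : 0 < e ->
    `|complex.Re g - h| <= e + e /\ `|complex.Im g| <= e + e.
  have eq0 (w : R) : (forall e : R, 0 < e -> `|w| <= e + e) -> w = 0.
    move=> we; apply/eqP; rewrite -normr_le0; apply/ler_addgt0Pl => e e0.
    by rewrite addr0 (splitr e) we// divr_gt0.
  have Reg : complex.Re g = h.
    by apply/subr0_eq/eq0 => e /small[].
  have Img : complex.Im g = 0 by apply: eq0 => e /small[].
  by case: g Reg Img {small} => /= ? ? -> ->.
move=> e0.
have /cvgrPdist_lt/(_ e%:C) := cG; rewrite ltcR => /(_ e0).
move=> /nbhs_ballP[d /= d0 dG].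
(* The radius lives in [R[i]], but a positive element of [R[i]] is real. *)
have [rd dE rd0] : exists2 rd : R, d = rd%:C & 0 < rd.
  exists (complex.Re d); last by move: d0; rewrite ltcE => /andP[].
  by apply/esym/RRe_real/gtr0_real.
(* [K] dominates both [C1] and [|a| + C2], so [y K <= e] controls the real and imaginary parts at
   once; the summand 1 makes [K] positive. *)
pose K := 1 + `|C1| + `|a| + `|C2|.
have K0 : 0 < K.
  by rewrite /K -!addrA ltr_pwDl// !addr_ge0.
pose y := Num.min (rd / 2) (e / K).
have y0 : 0 < y by rewrite lt_min !divr_gt0.
have yrd : y < rd.
  apply: (@le_lt_trans _ _ (rd / 2)); first by rewrite ge_min lexx.
  by rewrite ltr_pdivrMr// ltr_pMr// ltr1n.
have yK : y * K <= e by rewrite -ler_pdivlMr// ge_min lexx orbT.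
have normCi (t : R) : `|0 +i* t| = `|t|%:C :> R[i].
  by rewrite normc_def /= expr0n /= add0r sqrtr_sqr.
have /dG : ball (v%:C : R[i]^o) d (v +i* y).
  rewrite -ball_normE /= /ball_ dE.
  have -> : v%:C - (v +i* y) = 0 +i* (- y) :> R[i].
    by apply/eqP; rewrite eq_complex /= subrr sub0r !eqxx.
  by rewrite normCi normrN gtr0_norm// ltcR.
have Hy : upper_half_plane (v +i* y) by [].
rewrite -/g GF// => dist_lt.
have [_ _ /(_ _ Hy) FE] := repF.
have ReF : complex.Re (F (v +i* y)) - h =
    \int[mu]_x complex.Re (herglotz_kernel (v +i* y) x) -
    \int[mu]_(x in D) real_kernel R v x.
  by rewrite FE /complex_integral /= /h /boundary_value; simpc => /=; ring.
have ImF : complex.Im (F (v +i* y)) =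
    a * y + \int[mu]_x complex.Im (herglotz_kernel (v +i* y) x).
  by rewrite FE /complex_integral /=; simpc => /=; ring.
have Re_lt : `|complex.Re g - complex.Re (F (v +i* y))| < e.
  rewrite -ltcR (le_lt_trans _ dist_lt)//.
  by have := normc_ge_Re (g - F (v +i* y)); rewrite raddfB.
have Im_lt : `|complex.Im g - complex.Im (F (v +i* y))| < e.
  rewrite -ltcR (le_lt_trans _ dist_lt)//.
  (* Multiplication by ['i] preserves the modulus and turns the imaginary part into minus the real
     part. *)
  have := normc_ge_Re ((g - F (v +i* y)) * 'i).
  by rewrite ReiNIm normrN normrM normCi normr1 mulr1 raddfB.
have Re_le : `|complex.Re (F (v +i* y)) - h| <= e.
  rewrite ReF (le_trans (ReC _ y0))// (le_trans _ yK)// ler_pM2l//.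
  rewrite (le_trans (ler_norm _))// /K.
  by have := normr_ge0 a; have := normr_ge0 C2; lra.
have Im_le : `|complex.Im (F (v +i* y))| <= e.
  rewrite ImF (le_trans (ler_normD _ _))//.
  have ImC2 := ImC _ y0; rewrite normrM (gtr0_norm y0) mulrC.
  apply: (le_trans (lerD (lexx _) ImC2)).
  rewrite -mulrDr (le_trans _ yK)// ler_pM2l// /K.
  by have := ler_norm C2; have := normr_ge0 C1; lra.
split.
  have -> : complex.Re g - h = (complex.Re g - complex.Re (F (v +i* y))) +
    (complex.Re (F (v +i* y)) - h) by ring.
  by rewrite (le_trans (ler_normD _ _))// lerD// ltW.
have -> : complex.Im g = (complex.Im g - complex.Im (F (v +i* y))) +
    complex.Im (F (v +i* y)) by ring.
by rewrite (le_trans (ler_normD _ _))// lerD// ltW.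
Qed.

(** * Difference quotients as integrals *)

Lemma difference_quotient_boundary u v : l < u < r -> l < v < r ->
  difference_quotient G u v =
    ((boundary_value u - boundary_value v) / (u - v))%:C.
Proof.
move=> lur lvr; rewrite /difference_quotient !analytic_extensionE//.
by rewrite -!rmorphB -fmorphV -rmorphM.
Qed.

Lemma real_kernel_quotient u v x : D x -> l < u < r -> l < v < r -> u != v ->
  (u - v)^-1 * (real_kernel R u x - real_kernel R v x) =
    (x - u)^-1 * (x - v)^-1.
Proof.
move=> Dx lur lvr uv.
have neq w : l < w < r -> x - w != 0.
  move=> /dist_setC_itv[d d0 /(_ _ Dx) dx].
  by rewrite -normr_gt0 (lt_le_trans d0).
rewrite /real_kernel opprB addrA subrK; field.
by rewrite !neq// subr_eq0.
Qed.

Lemma integrable_real_kernel_quotient u v : l < u < r -> l < v < r -> u != v ->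
  mu.-integrable D (EFin \o fun x : T => (x - u)^-1 * (x - v)^-1).
Proof.
move=> lur lvr uv.
have iB := integrableB mD (integrable_real_kernel _ lur)
  (integrable_real_kernel _ lvr).
apply: (eq_integrable mD _ _ _ (integrableZl mD (u - v)^-1 iB)) => x.
by rewrite inE => Dx /=; rewrite -EFinB -EFinM real_kernel_quotient.
Qed.

(** The affine part contributes its slope [a]; in the kernels the terms [x / (1 + x^2)] cancel and
    partial fractions give the product. *)
Lemma boundary_value_quotient u v : l < u < r -> l < v < r -> u != v ->
  (boundary_value u - boundary_value v) / (u - v) =
    a + \int[mu]_(x in D) ((x - u)^-1 * (x - v)^-1).
Proof.
move=> lur lvr uv; have uv0 : u - v != 0 by rewrite subr_eq0.
have iu := integrable_real_kernel _ lur.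
have iv := integrable_real_kernel _ lvr.
have -> : \int[mu]_(x in D) ((x - u)^-1 * (x - v)^-1) =
    (u - v)^-1 * (\int[mu]_(x in D) real_kernel R u x -
                  \int[mu]_(x in D) real_kernel R v x).
  rewrite -(RintegralB mD iu iv) -(RintegralZl _ mD (integrableB mD iu iv)).
  by apply: eq_Rintegral => x; rewrite inE => Dx; rewrite real_kernel_quotient.
by rewrite /boundary_value; field.
Qed.

End BoundaryValue.

(** * Comparison of the integrands and the final inequality *)

Lemma quotient_kernel_dist_le (R : realType) (L W u u0 u1 x : R) :
  0 < W -> W < L / 10 -> - W <= u <= W -> - W <= u0 <= W -> - W <= u1 <= W ->
  L <= `|x| ->
  `|(x - u)^-1 * (x - u0)^-1 - (x - u1)^-1 * (x - u0)^-1| <=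
    6 * W / L * ((x - u1)^-1 * (x - u0)^-1).
Proof.
move=> W0 WL Wu Wu0 Wu1 Lx.
have L0 : 0 < L by lra.
(* Here [|x - w| >= L - W > 9 L / 10]; the weaker [L / 3] suffices, since [2 W] divided by it is
   [6 W / L]. *)
have far w : - W <= w <= W -> x - w != 0 /\ L <= 3 * `|x - w|.
  rewrite -ler_norml => Ww; have := lerB_dist x w => xw.
  have : L <= 3 * `|x - w| by lra.
  by split=> //; rewrite -normr_gt0; lra.
have [xu Lxu] := far _ Wu; have [xu0 _] := far _ Wu0; have [xu1 _] := far _ Wu1.
(* [x] lies to one side of [[-W, W]], so both factors have the same sign. *)
have p0 : 0 < (x - u1)^-1 * (x - u0)^-1.
  rewrite -invfM invr_gt0; move: Lx; rewrite ler_normr => /orP[Lx|Lx].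
    by rewrite mulr_gt0//; lra.
  by rewrite nmulr_rgt0; lra.
have -> : (x - u)^-1 * (x - u0)^-1 - (x - u1)^-1 * (x - u0)^-1 =
    (u - u1) / (x - u) * ((x - u1)^-1 * (x - u0)^-1).
  by field; rewrite xu xu0 xu1.
rewrite normrM (gtr0_norm p0) ler_pM2r// normrM normfV.
rewrite ler_pdivrMr ?normr_gt0// mulrAC ler_pdivlMr//.
have uu1 : `|u - u1| <= 2 * W by rewrite ler_norml; lra.
apply: (@le_trans _ _ (2 * W * (3 * `|x - u|))); last by lra.
by apply: ler_pM => //; exact: ltW.
Qed.

(* The inequality is in the order of R[i], where z <= w means that w - z is a
   nonnegative real; in particular the right-hand side is claimed to be real. *)
Theorem theorem4p2 (R : realType) (L : R) (F G : R[i]^o -> R[i]^o)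
    (L_gt0 : 0 < L) (PF : pick_class (- L) L F)
    (extG : analytic_extension (- L) L F G)
    (W : R) (W_gt0 : 0 < W) (ltWL : W < L / 10)
    (u u0 u1 : R)
    (Wu : - W <= u <= W) (Wu0 : - W <= u0 <= W) (Wu1 : - W <= u1 <= W)
    (neq_uu0 : u != u0) (neq_u1u0 : u1 != u0) :
  `|difference_quotient G u u0 - difference_quotient G u1 u0| <=
    (6 * W / L)%:C * difference_quotient G u1 u0.
Proof.
have [_ [a [b [mu [repF null_itv]]]]] := PF.
have [a0 wfin _] := repF.
have inside w : - W <= w <= W -> - L < w < L by lra.
have [Lu Lu0 Lu1] := And3 (inside _ Wu) (inside _ Wu0) (inside _ Wu1).
rewrite !(difference_quotient_boundary _ _ wfin _ _ null_itv _ _ _ _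
  repF extG)//.
rewrite !boundary_value_quotient//.
have mD : measurable (~` `]- L, L[ : set (measurableTypeR R)).
  exact: measurableC.
have iu := integrable_real_kernel_quotient _ _ wfin _ _ _ _ Lu Lu0 neq_uu0.
have iu1 := integrable_real_kernel_quotient _ _ wfin _ _ _ _ Lu1 Lu0 neq_u1u0.
(* Both sides are embedded reals, so the claim becomes an inequality in [R]; the two copies of [a]
   on the left then cancel. *)
rewrite -rmorphB -rmorphM normc_def /= expr0n addr0 sqrtr_sqr lecR.
rewrite opprD addrACA subrr add0r -(RintegralB mD iu iu1) mulrDr.
apply: (le_trans (le_normr_Rintegral mD (integrableB mD iu iu1))).
apply: (@le_trans _ _ (6 * W / L *
    \int[mu]_(x in ~` `]- L, L[) ((x - u1)^-1 * (x - u0)^-1))); last first.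
  by rewrite lerDr mulr_ge0// divr_ge0// ?mulr_ge0// ltW.
rewrite -(RintegralZl _ mD iu1); apply: (le_Rintegral mD).
- exact: (integrable_norm (integrableB mD iu iu1)).
- exact: (integrableZl mD _ iu1).
- move=> x Dx; apply: (@quotient_kernel_dist_le _ L) => //.
  rewrite leNgt ltr_norml; apply/negP => xL; apply: Dx.
  by rewrite /= in_itv.
Qed.
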